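(* Let $r\ge1$ be an integer, let $(d_n)_{n\ge1}$ be a sequence of positive real numbers, and let $D(z)=\sum_{n=1}^\infty d_nz^n$. Let $c_n^{(r)}$ be the coefficients defined by $$\frac1{(1-D(z))^r}=\sum_{n=0}^\infty c_n^{(r)}z^n .$$ Then $$c_0^{(r)}=1,\qquad c_n^{(r)}=\frac1n\sum_{k=1}^{n}\bigl[n+(r-1)k\bigr]d_k\,c_{n-k}^{(r)}\quad(n\ge1).$$ In particular, $c_n^{(r)}>0$ for all $n\ge0$. If all $d_k$ are rational, then every $c_n^{(r)}$ is rational.
   Context: The series are understood as (formal) power series in $z$; since $D$ has zero constant term, $(1-D(z))^{-r}$ is a well-defined power series. *)

(* Defs.v *)
From HB Require Import structures.
From mathcomp Require Import all_boot all_order all_algebra.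
From mathcomp Require Import boolp reals.

Set Implicit Arguments.
Unset Strict Implicit.
Unset Printing Implicit Defensive.

Import Order.TTheory GRing.Theory Num.Theory.
Local Open Scope ring_scope.

(* Formal power series. The wrapper keeps the Cauchy product from clashing
   with the pointwise ring structure on functions. *)
Record fps (R : Type) := Fps { fps_coef : nat -> R }.

Lemma fpsP (R : Type) (a b : fps R) :
  (forall n, fps_coef a n = fps_coef b n) -> a = b.
Proof. by case: a b => [a] [b] /= h; congr Fps; apply/funext. Qed.

HB.instance Definition _ (R : Type) := gen_eqMixin (fps R).
HB.instance Definition _ (R : Type) := gen_choiceMixin (fps R).

Section FpsZmodule.
Variable R : zmodType.
Implicit Types a b c : fps R.

Definition fps_zero : fps R := Fps (fun _ => 0).
Definition fps_opp a : fps R := Fps (fun n => - fps_coef a n).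
Definition fps_add a b : fps R := Fps (fun n => fps_coef a n + fps_coef b n).

Fact fps_addA : associative fps_add.
Proof. by move=> a b c; apply: fpsP => n /=; rewrite addrA. Qed.
Fact fps_addC : commutative fps_add.
Proof. by move=> a b; apply: fpsP => n /=; rewrite addrC. Qed.
Fact fps_add0 : left_id fps_zero fps_add.
Proof. by move=> a; apply: fpsP => n /=; rewrite add0r. Qed.
Fact fps_addN : left_inverse fps_zero fps_opp fps_add.
Proof. by move=> a; apply: fpsP => n /=; rewrite addNr. Qed.

HB.instance Definition _ :=
  GRing.isZmodule.Build (fps R) fps_addA fps_addC fps_add0 fps_addN.

End FpsZmodule.

Section FpsRing.
Variable R : comNzRingType.
Implicit Types a b c : fps R.

Definition fps_one : fps R := Fps (fun n => (n == 0%N)%:R).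
Definition fps_mul a b : fps R :=
  Fps (fun n => \sum_(i < n.+1) fps_coef a i * fps_coef b (n - i)%N).

(* Truncation to a polynomial, to inherit the ring laws of {poly R}. *)
Let trunc m a : {poly R} := \poly_(i < m) fps_coef a i.

Let coef_trunc m a i : (i < m)%N -> (trunc m a)`_i = fps_coef a i.
Proof. by move=> lt_im; rewrite coef_poly lt_im. Qed.

Let coef_mul m a b i :
  (i < m)%N -> (trunc m a * trunc m b)`_i = fps_coef (fps_mul a b) i.
Proof.
move=> lt_im; rewrite coefM; apply: eq_bigr => j _.
have le_ji : (j <= i)%N by rewrite -ltnS.
by rewrite !coef_trunc ?(leq_ltn_trans _ lt_im) ?leq_subr.
Qed.

Fact fps_mulC : commutative fps_mul.
Proof.
by move=> a b; apply: fpsP => n; rewrite -!(coef_mul _ _ (ltnSn n)) mulrC.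
Qed.

Fact fps_mulA : associative fps_mul.
Proof.
move=> a b c; apply: fpsP => n.
transitivity ((trunc n.+1 a * (trunc n.+1 b * trunc n.+1 c))`_n).
  rewrite coefM; apply: eq_bigr => i _.
  by rewrite coef_trunc // coef_mul // ltnS leq_subr.
rewrite mulrA coefM; apply: eq_bigr => i _.
by rewrite coef_mul // coef_trunc // ltnS leq_subr.
Qed.

Fact fps_mul1 : left_id fps_one fps_mul.
Proof.
move=> a; apply: fpsP => n /=; rewrite big_ord_recl /= mul1r subn0.
by rewrite big1 ?addr0 // => i _; rewrite mul0r.
Qed.

Fact fps_mulDl : left_distributive fps_mul +%R.
Proof.
move=> a b c; apply: fpsP => n /=; rewrite -big_split /=.
by apply: eq_bigr => i _; rewrite mulrDl.
Qed.

Fact fps_one_neq0 : fps_one != 0.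
Proof.
apply/eqP => /(congr1 (fun a => fps_coef a 0%N)) /= /eqP.
by rewrite oner_eq0.
Qed.

HB.instance Definition _ := GRing.Zmodule_isComNzRing.Build (fps R)
  fps_mulA fps_mulC fps_mul1 fps_mulDl fps_one_neq0.

End FpsRing.

Section FpsUnitRing.
Variable R : comUnitRingType.
Implicit Types a b : fps R.

Definition fps_unit : {pred fps R} := fun a => fps_coef a 0%N \is a GRing.unit.

(* The first n coefficients b_0, ..., b_(n-1) of the series b with b * a = 1:
   b_m = a_0^-1 * ([m = 0] - \sum_(i < m) b_i * a_(m - i)). *)
Fixpoint fps_inv_seq a n : seq R :=
  if n is m.+1 then
    let s := fps_inv_seq a m in
    rcons s ((fps_coef a 0%N)^-1 *
             ((m == 0%N)%:R - \sum_(i < m) s`_i * fps_coef a (m - i)%N))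
  else [::].

(* Non-units are left unchanged, following the convention of unitRingType. *)
Definition fps_inv a : fps R :=
  if a \in fps_unit then Fps (fun n => (fps_inv_seq a n.+1)`_n) else a.

Lemma size_fps_inv_seq a n : size (fps_inv_seq a n) = n.
Proof. by elim: n => //= n IHn; rewrite size_rcons IHn. Qed.

Lemma nth_fps_inv_seq a n i : (i < n)%N ->
  (fps_inv_seq a n)`_i = (fps_inv_seq a i.+1)`_i.
Proof.
elim: n => // n IHn; rewrite ltnS leq_eqVlt => /predU1P[-> //|lt_in].
by rewrite -(IHn lt_in) [fps_inv_seq a n.+1]/= nth_rcons size_fps_inv_seq lt_in.
Qed.

Fact fps_mulVx : {in fps_unit, left_inverse 1 fps_inv *%R}.
Proof.
move=> a ua; rewrite /fps_inv ua; apply: fpsP => n.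
rewrite [LHS]/= big_ord_recr /= subnn nth_rcons size_fps_inv_seq ltnn eqxx.
rewrite -mulrA mulrCA mulVr // mulr1.
rewrite [X in _ - X](_ : _ =
  \sum_(i < n) (fps_inv_seq a i.+1)`_i * fps_coef a (n - i)%N).
  by rewrite addrC subrK.
by apply: eq_bigr => i _; rewrite nth_fps_inv_seq.
Qed.

Fact fps_unitPl a b : b * a = 1 -> fps_unit a.
Proof.
move=> /(congr1 (fun c => fps_coef c 0%N)) /=.
by rewrite big_ord_recl big_ord0 addr0 subnn /= => h; apply/unitrPr;
  exists (fps_coef b 0%N); rewrite mulrC.
Qed.

Fact fps_inv_out : {in [predC fps_unit], fps_inv =1 id}.
Proof. by move=> a /negbTE ua; rewrite /fps_inv ua. Qed.

HB.instance Definition _ := GRing.ComNzRing_hasMulInverse.Build (fps R)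
  fps_mulVx fps_unitPl fps_inv_out.

Lemma fps_unitE a : (a \is a GRing.unit) = (fps_coef a 0%N \is a GRing.unit).
Proof. by []. Qed.

(* Hence (1 - D) ^- r is a genuine inverse when D has no constant term. *)
Lemma fps_unit_1sub (D : fps R) : fps_coef D 0%N = 0 -> 1 - D \is a GRing.unit.
Proof. by move=> D0; rewrite fps_unitE /= D0 subr0 unitr1. Qed.

End FpsUnitRing.

(* \sum_(n >= 1) d_n z^n; the value d 0 is ignored. *)
Definition fps_of_pos (R : zmodType) (d : nat -> R) : fps R :=
  Fps (fun n => if n is 0%N then 0 else d n).

(* Main.v *)
Require Import Defs.
From HB Require Import structures.
From mathcomp Require Import all_boot all_order all_algebra.
From mathcomp Require Import boolp reals.
From mathcomp Require Import ring.

Import Order.TTheory GRing.Theory Num.Theory.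
Local Open Scope ring_scope.

(** Apply the Euler operator theta = z d/dz, which multiplies the n-th
    coefficient by n and is a derivation ([euler_fpsM]), to the series
    C = (1 - D)^-r.  The power rule for derivations ([euler_fpsXV]) gives
    the differential equation

      (1 - D) theta(C) = r theta(D) C,   i.e.
      theta(C) = D theta(C) + r theta(D) C,

    whose coefficient of z^n reads

      n c_n = \sum_(k = 1..n) (n - k) d_k c_(n-k) + r k d_k c_(n-k).

    As (n - k) + r k = n + (r - 1) k, this is the recurrence
    ([fps_coef_1subXV_rec]).  It expresses n c_n through the d_k
    and the earlier coefficients with integer weights that are positive when
    r >= 1, so positivity and rationality follow by strong induction from
    c_0 = 1. *)

Definition euler_fps {R : nzRingType} (a : fps R) : fps R :=
  Fps (fun n => n%:R * fps_coef a n).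

Section EulerOperator.
Variable R : comNzRingType.
Implicit Types a b : fps R.

Lemma euler_fps1 : euler_fps (1 : fps R) = 0.
Proof. by apply: fpsP => -[|n] /=; rewrite ?mul0r ?mulr0. Qed.

Lemma euler_fpsB a b : euler_fps (a - b) = euler_fps a - euler_fps b.
Proof. by apply: fpsP => n /=; rewrite mulrBr. Qed.

(** Leibniz rule: the terms of the Cauchy product in degree n are the
    a_i b_(n-i), and their common weight n splits as i + (n - i). *)
Lemma euler_fpsM a b :
  euler_fps (a * b) = euler_fps a * b + a * euler_fps b.
Proof.
apply: fpsP => n; rewrite /= mulr_sumr -big_split /=; apply: eq_bigr => i _.
have le_in : (i <= n)%N by rewrite -ltnS.
rewrite -{1}(subnKC le_in) natrD; ring.
Qed.

(** The power rule in the division-free form a theta(a^n) = n theta(a) a^n,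
    so that it makes sense also for n = 0. *)
Lemma euler_fpsX a n : a * euler_fps (a ^+ n) = n%:R * euler_fps a * a ^+ n.
Proof.
elim: n => [|n IHn]; first by rewrite expr0 euler_fps1 mulr0 !mul0r.
by rewrite exprS euler_fpsM mulrDr (mulrCA a a) IHn -natr1; ring.
Qed.

Lemma fps_coef0M a b : fps_coef (a * b) 0%N = fps_coef a 0%N * fps_coef b 0%N.
Proof. by rewrite /= big_ord_recl big_ord0 addr0. Qed.

Lemma fps_coef0X a n : fps_coef (a ^+ n) 0%N = fps_coef a 0%N ^+ n.
Proof. by elim: n => // n IHn; rewrite !exprS fps_coef0M IHn. Qed.

End EulerOperator.

(** The power rule for negative exponents, obtained by applying theta to
    a^n a^-n = 1. *)
Lemma euler_fpsXV {R : comUnitRingType} (a : fps R) (n : nat) :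
  a \is a GRing.unit ->
  a * euler_fps (a ^- n) = - (n%:R * euler_fps a * a ^- n).
Proof.
move=> ua; have uan : a ^+ n \is a GRing.unit by rewrite unitrX.
have := congr1 euler_fps (divrr uan).
rewrite euler_fpsM euler_fps1 => /(congr1 ( *%R a)).
rewrite mulr0 mulrDr mulrA euler_fpsX => /eqP.
rewrite addr_eq0 eq_sym eqr_oppLR => /eqP eq_an.
by apply: (mulrI uan); rewrite mulrCA eq_an mulrN mulrA (mulrC (a ^+ n)).
Qed.

Section NegativePower.
Variables (R : comUnitRingType) (d : nat -> R) (r : nat).
Let D : fps R := fps_of_pos d.
Let C : fps R := (1 - D) ^- r.

Lemma fps_coef_1subXV0 : fps_coef C 0%N = 1.
Proof.
have uD : (1 - D) ^+ r \is a GRing.unit by rewrite unitrX ?fps_unit_1sub.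
have := congr1 (fun a => fps_coef a 0%N) (divrr uD).
by rewrite fps_coef0M fps_coef0X /= subr0 expr1n mul1r.
Qed.

Lemma fps_coef_1subXV_rec (n : nat) :
  n%:R * fps_coef C n =
    \sum_(1 <= k < n.+1) (n%:R + (r%:R - 1) * k%:R) * d k * fps_coef C (n - k)%N.
Proof.
have eqC : euler_fps C = D * euler_fps C + euler_fps D * (C *+ r).
  have := @euler_fpsXV R (1 - D) r (fps_unit_1sub (erefl : fps_coef D 0%N = 0)).
  rewrite -/C euler_fpsB euler_fps1 sub0r mulrBl mul1r => /eqP.
  rewrite subr_eq => /eqP {1}->.
  by rewrite mulrN mulNr opprK addrC -mulrA mulr_natl mulrnAr.
have coefMn m : fps_coef (C *+ r) m = r%:R * fps_coef C m.
  by elim: (r) => [|s IHs]; rewrite ?mul0r // mulrS /= IHs -natr1; ring.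
rewrite -[LHS]/(fps_coef (euler_fps C) n) {1}eqC /= -big_split /=.
(* The term of index 0 vanishes because D has no constant term. *)
rewrite big_ord_recl /= mulr0 !mul0r !add0r.
rewrite big_add1 big_mkord; apply: eq_bigr => i _.
rewrite coefMn /bump add1n natrB ?ltn_ord //; ring.
Qed.

End NegativePower.

Section Rational.
Variable R : realType.
Implicit Types x y : R.

Lemma rational_nat n : rational (n%:R : R).
Proof. by exists n%:R; rewrite ?ratr_nat. Qed.

Lemma rationalD x y : rational x -> rational y -> rational (x + y).
Proof. by move=> [p _ <-] [q _ <-]; exists (p + q); rewrite ?rmorphD. Qed.

Lemma rationalB x y : rational x -> rational y -> rational (x - y).
Proof. by move=> [p _ <-] [q _ <-]; exists (p - q); rewrite ?rmorphB. Qed.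

Lemma rationalM x y : rational x -> rational y -> rational (x * y).
Proof. by move=> [p _ <-] [q _ <-]; exists (p * q); rewrite ?rmorphM. Qed.

Lemma rationalV x : rational x -> rational x^-1.
Proof. by move=> [p _ <-]; exists p^-1; rewrite ?fmorphV. Qed.

End Rational.

Theorem theorem4p2 (R : realType) (r : nat) (hr : (1 <= r)%N)
    (d : nat -> R) (hd : forall n : nat, (1 <= n)%N -> 0 < d n) :
  let D : fps R := fps_of_pos d in
  let c : nat -> R := fps_coef ((1 - D) ^- r) in
  [/\ c 0%N = 1,
      forall n : nat, (1 <= n)%N ->
        c n = n%:R^-1 *
              \sum_(1 <= k < n.+1)
                 (n%:R + (r%:R - 1) * k%:R) * d k * c (n - k)%N,
      forall n : nat, 0 < c n
    & (forall k : nat, (1 <= k)%N -> rational (d k)) ->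
        forall n : nat, rational (c n)].
Proof.
move=> D c.
have c0 : c 0%N = 1 by exact: fps_coef_1subXV0.
have c_rec n : (1 <= n)%N -> c n = n%:R^-1 *
    \sum_(1 <= k < n.+1) (n%:R + (r%:R - 1) * k%:R) * d k * c (n - k)%N.
  by move=> n1; rewrite -fps_coef_1subXV_rec mulKf // pnatr_eq0 -lt0n.
split=> // [n|rat_d n]; elim/ltn_ind: n => -[|n] IHn.
- by rewrite c0.
- have term_gt0 k : (1 <= k < n.+2)%N ->
      0 < (n.+1%:R + (r%:R - 1) * k%:R) * d k * c (n.+1 - k)%N.
    case/andP=> k1 _; rewrite !mulr_gt0 ?hd ?IHn ?ltn_subrL ?k1 //.
    by rewrite ltr_wpDr ?ltr0n // mulr_ge0 ?ler0n // subr_ge0 ler1n.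
  rewrite c_rec // mulr_gt0 ?invr_gt0 ?ltr0n // big_ltn // ltr_wpDr ?term_gt0 //.
  rewrite big_nat_cond sumr_ge0 // => k; rewrite andbT => /andP[k2 kn].
  by rewrite ltW // term_gt0 // ltnW.
- by rewrite c0; exact: rational_nat 1%N.
- rewrite c_rec //; apply: rationalM; first exact/rationalV/rational_nat.
  rewrite big_nat_cond; elim/big_ind: _ => [||k /andP[/andP[k1 _] _]].
  + exact: rational_nat 0%N.
  + exact: rationalD.
  + apply: rationalM; last by apply: IHn; rewrite ltn_subrL k1.
    apply: rationalM; last exact: rat_d.
    apply: rationalD; first exact: rational_nat.
    apply: rationalM; last exact: rational_nat.
    by apply: rationalB; [exact: rational_nat | exact: rational_nat 1%N].
Qed.
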